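(* Let $\mathbb{F}$ be a field endowed with a nontrivial absolute value $|\cdot|$, equipped with the metric $d(x,y)=|x-y|$, and let $\mathbb{F}\times\mathbb{F}$ be equipped with the maximum metric. Then the multiplication map $m:\mathbb{F}\times\mathbb{F}\to\mathbb{F}$ given by $m(x,y)=xy$ is uniformly open.
   Context: An absolute value on a field $\mathbb{F}$ is a function $|\cdot|:\mathbb{F}\to[0,\infty)$ with (i) $|x|=0$ if and only if $x=0$; (ii) $|xy|=|x||y|$ for all $x,y$; (iii) $|x+y|\le|x|+|y|$ for all $x,y$. It is trivial if $|0|=0$ and $|x|=1$ for all $x\neq0$, and nontrivial otherwise. (The absolute value may be archimedean or non-archimedean.) A function $f:X\to Y$ between metric spaces is uniformly open if for every $\varepsilon>0$ there exists $\delta>0$ such that for every $x\in X$, $B_Y(f(x),\delta)\subseteq f(B_X(x,\varepsilon))$, where $B_X(x,\varepsilon)$ and $B_Y(y,\delta)$ denote open balls. The maximum metric on a product $X\times Y$ of metric spaces $(X,d_X)$, $(Y,d_Y)$ is $d((x,y),(s,t))=\max\{d_X(x,s),d_Y(y,t)\}$. *)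

(* Defs.v *)
From HB Require Import structures.
From mathcomp Require Import all_boot all_order all_algebra.
From mathcomp Require Import all_classical all_reals topology.

Set Implicit Arguments.
Unset Strict Implicit.
Unset Printing Implicit Defensive.

Import Order.TTheory GRing.Theory Num.Theory.

Local Open Scope classical_set_scope.
Local Open Scope ring_scope.

(* The norm of a numFieldType is not used: it is always archimedean on the
   prime field, whereas non-archimedean absolute values are allowed here. *)
Record absolute_value (R : realType) (F : fieldType) := AbsoluteValue {
  absv :> F -> R;
  absv_ge0 : forall x, 0 <= absv x;
  absv_eq0 : forall x, absv x = 0 <-> x = 0;
  absvM : forall x y, absv (x * y) = absv x * absv y;
  absv_leD : forall x y, absv (x + y) <= absv x + absv y
}.

Definition trivial_absv (R : realType) (F : fieldType)
    (a : absolute_value R F) : Prop :=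
  a 0 = 0 /\ forall x, x != 0 -> a x = 1.

Definition nontrivial_absv (R : realType) (F : fieldType)
    (a : absolute_value R F) : Prop := ~ trivial_absv a.

(* Copy of the field F carrying the metric induced by the absolute value a. *)
Definition valued (R : realType) (F : fieldType)
  (a : absolute_value R F) : Type := F.

HB.instance Definition _ (R : realType) (F : fieldType)
  (a : absolute_value R F) := GRing.Field.on (valued a).

Section valued_metric.
Context {R : realType} {F : fieldType} (a : absolute_value R F).

Definition valued_dist (x y : valued a) : R := a (x - y).

Let absvN1 : a (-1) = 1.
Proof.
have a1 : a 1 != 0 by apply/eqP => /absv_eq0/eqP; rewrite oner_eq0.
have a1E : a 1 = 1 by apply: (mulfI a1); rewrite -absvM !mulr1.
apply/eqP; rewrite -(@eqrXn2 _ 2) ?absv_ge0 ?ler01//.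
by rewrite expr2 -absvM mulrNN mulr1 a1E expr1n.
Qed.

Let valued_distxx x : valued_dist x x = 0.
Proof. by apply/absv_eq0; rewrite subrr. Qed.

Let valued_dist_positivity x y : valued_dist x y = 0 -> x = y.
Proof. by move=> /absv_eq0/eqP; rewrite subr_eq0 => /eqP. Qed.

Let valued_dist_sym x y : valued_dist x y = valued_dist y x.
Proof. by rewrite /valued_dist -opprB -mulN1r absvM absvN1 mul1r. Qed.

Let valued_dist_triangle y x z :
  valued_dist x z <= valued_dist x y + valued_dist y z.
Proof. by rewrite /valued_dist -[x - z](subrKA y) absv_leD. Qed.

HB.instance Definition _ := @isMetric.Build R (valued a) valued_dist
  valued_distxx valued_dist_positivity valued_dist_sym valued_dist_triangle.

Lemma mdist_valuedE (x y : valued a) : mdist x y = a (x - y).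
Proof. by []. Qed.

End valued_metric.

(* The library's pseudometric on a product has the max-metric balls; this adds
   the distance itself. *)
Section prod_metric.
Context {R : realFieldType} {X Y : metricType R}.

Definition prod_mdist (p q : X * Y) : R :=
  Num.max (mdist p.1 q.1) (mdist p.2 q.2).

Let prod_mdist_ge0 p q : 0 <= prod_mdist p q.
Proof. by rewrite /prod_mdist le_max mdist_ge0. Qed.

Let prod_mdist_positivity p q : prod_mdist p q = 0 -> p = q.
Proof.
case: p q => [x y] [s t] d0.
have /andP[dx dy] : (mdist x s <= 0) && (mdist y t <= 0).
  by rewrite -ge_max -/(prod_mdist (x, y) (s, t)) d0.
by congr pair; apply: mdist_positivity; apply/eqP;
  rewrite eq_le mdist_ge0 andbT.
Qed.

Let ballE_prod_mdist (p : X * Y) d : ball p d = [set q | prod_mdist p q < d].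
Proof.
apply/seteqP; split=> q; rewrite /ball/= /prod_ball !ballEmdist/=.
  by move=> [? ?]; rewrite /prod_mdist gt_max; apply/andP.
by rewrite /prod_mdist gt_max => /andP.
Qed.

HB.instance Definition _ := @PseudoMetric_isMetric.Build R (X * Y)%type
  prod_mdist prod_mdist_ge0 prod_mdist_positivity ballE_prod_mdist.

Lemma mdist_prodE (p q : X * Y) :
  mdist p q = Num.max (mdist p.1 q.1) (mdist p.2 q.2).
Proof. by []. Qed.

End prod_metric.

(* By ballEmdist, ball x e is the open ball [set y | mdist x y < e]. *)
Definition uniformly_open (R : realType) (X Y : metricType R)
    (f : X -> Y) : Prop :=
  forall e : R, 0 < e -> exists2 d : R, 0 < d &
    forall x : X, ball (f x) d `<=` f @` ball x e.

(* Main.v *)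
Require Import Defs.
From mathcomp Require Import all_boot all_order all_algebra.
From mathcomp Require Import all_classical all_reals topology.
From mathcomp Require Import normedtype sequences lra.

Import Order.TTheory GRing.Theory Num.Theory.
Import numFieldNormedType.Exports.

Local Open Scope ring_scope.

(** Nontriviality gives p with 0 < |p| < e/2; put d = |p| (e/2 - |p|) and let
    |z - xy| < d. If |x| >= |p|, keep x and replace y by z/x, which moves it by
    less than d/|p| < e; similarly if |y| >= |p|. If |x|, |y| < |p|, then
    |z| < |p|^2 + d = |p| e/2, so p and z/p both have absolute value < e/2 and
    hence lie within e of x and y. *)

Section absolute_value_theory.
Context {R : realType} {F : fieldType} (a : absolute_value R F).

Lemma absv0 : a 0 = 0.
Proof. exact/absv_eq0. Qed.

Lemma absv_gt0 x : (0 < a x) = (x != 0).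
Proof.
rewrite lt_def absv_ge0 andbT; congr (~~ _).
by apply/eqP/eqP => [/absv_eq0|->]//; exact: absv0.
Qed.

Lemma absv1 : a 1 = 1.
Proof.
have a1 : a 1 != 0 by rewrite gt_eqF// absv_gt0 oner_neq0.
by apply: (mulfI a1); rewrite -absvM !mulr1.
Qed.

Lemma absvX x n : a (x ^+ n) = a x ^+ n.
Proof. by elim: n => [|n IHn]; rewrite ?absv1// !exprS absvM IHn. Qed.

Lemma absvV x : a x^-1 = (a x)^-1.
Proof.
have [->|x0] := eqVneq x 0; first by rewrite invr0 absv0 invr0.
have ax0 : a x != 0 by rewrite gt_eqF// absv_gt0.
by apply: (mulfI ax0); rewrite -absvM !divff// absv1.
Qed.

(** This amounts to |-1| = 1, which the symmetry of the metric on [valued a] already contains. *)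
Lemma absv_distC x y : a (x - y) = a (y - x).
Proof. exact: (@metric_sym _ (valued a)). Qed.

Lemma absv_leB x y : a (x - y) <= a x + a y.
Proof.
by have := absv_leD a x (- y); rewrite -[- y]sub0r absv_distC subr0 sub0r.
Qed.

(** Some nonzero c has |c| different from 1; either c or its inverse then serves. *)
Lemma nontrivial_absv_lt1 : nontrivial_absv a -> exists2 c, c != 0 & a c < 1.
Proof.
move=> nontriv_a.
have [c c0 ac1] : exists2 c, c != 0 & a c != 1.
  apply: contrapT => noc; apply: nontriv_a; split; first exact: absv0.
  by move=> x x0; apply/eqP/negPn/negP => ax1; apply: noc; exists x.
have [ac|] := ltP (a c) 1; first by exists c.
rewrite le_eqVlt eq_sym (negPf ac1)/= => ac; exists c^-1; rewrite ?invr_eq0//.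
by rewrite absvV invf_lt1// absv_gt0.
Qed.

(** High powers of a nonzero c with |c| < 1 serve, since |c|^n tends to 0. *)
Lemma nontrivial_absv_small (e : R) :
  nontrivial_absv a -> 0 < e -> exists2 p, p != 0 & a p < e.
Proof.
move=> /nontrivial_absv_lt1[c c0 ac1] e0.
have ac_norm : `|a c| < 1 by rewrite ger0_norm ?absv_ge0.
have /cvgrPdist_lt/(_ e e0)[n _ /(_ n (leqnn n))] := cvg_expr ac_norm.
rewrite /= sub0r normrN -absvX ger0_norm ?absv_ge0// => acn.
by exists (c ^+ n); rewrite ?expf_neq0.
Qed.

Lemma absv_sub_divl x y z : x != 0 -> a (y - z / x) = a (x * y - z) / a x.
Proof. by move=> x0; rewrite -absvV -absvM mulrBl mulrAC divff// mul1r. Qed.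

End absolute_value_theory.

Theorem theorem3p2 (R : realType) (F : fieldType) (a : absolute_value R F)
    (nontriv_a : nontrivial_absv a) :
  uniformly_open (fun p : valued a * valued a => p.1 * p.2).
Proof.
move=> e e0.
have [|p p0 ap_lt] := nontrivial_absv_small a (e / 2) nontriv_a.
  by rewrite divr_gt0.
have ap0 : 0 < a p by rewrite absv_gt0.
exists (a p * (e / 2 - a p)); first by rewrite mulr_gt0// subr_gt0.
have large u v z : a p <= a u -> a (u * v - z) < a p * (e / 2 - a p) ->
    u != 0 /\ a (v - z / u) < e.
  move=> pu uvz; have au0 := lt_le_trans ap0 pu.
  have u0 : u != 0 by rewrite -(absv_gt0 a).
  (* With the division cleared, the goal |uv - z| < e |u| follows from d < |p| e <= |u| e. *)
  split=> //; rewrite absv_sub_divl// ltr_pdivrMr//; nra.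
move=> [x y] z; rewrite ballEmdist /= mdist_valuedE => xyz.
suff [s [t [stz xs yt]]] : exists s t, [/\ s * t = z, a (x - s) < e & a (y - t) < e].
  (* Membership in the product ball unfolds to the two coordinate inequalities. *)
  by exists (s, t).
have [px|xp] := leP (a p) (a x).
  have [x0 yzx] := large x y z px xyz.
  exists x, (z / x); split=> //; first by rewrite mulrC divfK.
  by rewrite subrr absv0.
have [py|yp] := leP (a p) (a y).
  have [|y0 xzy] := large y x z py; first by rewrite mulrC.
  exists (z / y), y; split=> //; first by rewrite divfK.
  by rewrite subrr absv0.
exists p, (z / p); split; first by rewrite mulrC divfK.
  (* Here |x - p| <= |x| + |p| < 2|p| < e. *)
  by apply: le_lt_trans (absv_leB _ _ _) _; lra.
have az : a z < a p * (e / 2).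
  have : a z <= a x * a y + a (x * y - z).
    by rewrite -absvM -{1}[z](subKr (x * y)) absv_leB.
  (* Nonnegativity allows multiplying |x| < |p| and |y| < |p|; the resulting |p|^2 cancels against
     the -|p|^2 in d. *)
  have := absv_ge0 a x; have := absv_ge0 a y; nra.
have azp : a (z / p) < e / 2 by rewrite absvM absvV ltr_pdivrMr// mulrC.
by apply: le_lt_trans (absv_leB _ _ _) _; lra.
Qed.
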